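(* Let $L$ be a non-abelian finite-dimensional Lie algebra over a finite field $\mathbb{F}_q$. Then the non-commuting graph $G_L$ is Eulerian.
   Context: $\mathbb{F}_q$ denotes the finite field with $q$ elements. For a Lie algebra $L$, $Z(L)=\{x\in L : [x,y]=0 \text{ for all } y\in L\}$ is its centre. The non-commuting graph $G_L$ is the undirected simple graph with vertex set $L\setminus Z(L)$, in which two distinct vertices $x$ and $y$ are adjacent if and only if $[x,y]\neq 0$. A graph is Eulerian if it has a closed walk that traverses every edge of the graph exactly once. *)

(* Defs.v *)
From HB Require Import structures.
From mathcomp Require Import all_boot all_order all_algebra all_field.

Set Implicit Arguments.
Unset Strict Implicit.
Unset Printing Implicit Defensive.

Import GRing.Theory.
Local Open Scope ring_scope.

(* The bracket is required to be alternating, not merely antisymmetric: the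
   two differ in characteristic 2. *)
HB.mixin Record Lmodule_isLieAlgebra (R : comNzRingType) (L : Type)
    of GRing.Lmodule R L := {
  lie : L -> L -> L;
  lie_linearl : forall y : L, linear (fun x : L => lie x y);
  lie_linearr : forall x : L, linear (lie x);
  liexx : forall x : L, lie x x = 0;
  lie_jacobi : forall x y z : L,
    lie x (lie y z) + lie y (lie z x) + lie z (lie x y) = 0
}.

#[short(type="lieAlgType")]
HB.structure Definition LieAlgebra (R : comNzRingType) :=
  { L of GRing.Lmodule R L & Lmodule_isLieAlgebra R L }.

#[short(type="finDimLieAlgType")]
HB.structure Definition FinDimLieAlgebra (F : fieldType) :=
  { L of LieAlgebra F L & Vector F L }.

Definition lie_abelian (R : comNzRingType) (L : lieAlgType R) : Prop :=
  forall x y : L, lie x y = 0.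

Record sgraph := SGraph {
  svertex :> finType;
  sadj : rel svertex;
  sadj_sym : symmetric sadj;
  sadj_irr : irreflexive sadj
}.

(* A walk is given by its start x and the list p of the vertices visited after
   it; since the graph is simple, the edges are determined by the vertices.
   The pairs in zip (x :: p) p are the successive steps of the walk, and a step
   traverses the undirected edge {u, v} in either direction. *)
Definition closed_walk (G : sgraph) (x : G) (p : seq G) : bool :=
  path (@sadj G) x p && (last x p == x).

Definition traversals (G : sgraph) (x : G) (p : seq G) (u v : G) : nat :=
  count [pred e : G * G | (e == (u, v)) || (e == (v, u))] (zip (x :: p) p).

Definition eulerian (G : sgraph) : Prop :=
  exists (x : G) (p : seq G), closed_walk x p /\
    forall u v : G, sadj u v -> traversals x p u v = 1%N.

Section NonCommutingGraph.
Variables (F : finFieldType) (L : finDimLieAlgType F).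

(* finvect_type L is L itself, with the finType structure it has because F is
   finite and L is finite-dimensional. *)
Definition lie_center : {set finvect_type L} :=
  [set x : finvect_type L | [forall y : finvect_type L, lie (x : L) (y : L) == 0]].

Definition nc_vertex : finType := {x : finvect_type L | x \notin lie_center}.

Definition nc_adj : rel nc_vertex :=
  fun x y => (x != y) && (lie (val x : L) (val y : L) != 0).

Lemma lieC (x y : L) : lie x y = - lie y x.
Proof.
have addl (a b c : L) : lie (a + b) c = lie a c + lie b c.
  by have := lie_linearl c 1 a b; rewrite !scale1r.
have addr (a b c : L) : lie a (b + c) = lie a b + lie a c.
  by have := lie_linearr a 1 b c; rewrite !scale1r.
have := liexx (x + y); rewrite addl !addr !liexx add0r addr0 => /eqP.
by rewrite addr_eq0 => /eqP.
Qed.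

Lemma nc_adj_sym : symmetric nc_adj.
Proof. by move=> x y; rewrite /nc_adj eq_sym lieC oppr_eq0. Qed.

Lemma nc_adj_irr : irreflexive nc_adj.
Proof. by move=> x; rewrite /nc_adj eqxx. Qed.

Definition noncommuting_graph : sgraph := SGraph nc_adj_sym nc_adj_irr.

End NonCommutingGraph.

(* Main.v *)
Require Import Defs.
From HB Require Import structures.
From mathcomp Require Import all_boot all_order all_algebra all_field.

(** By Euler's theorem a nonempty finite connected graph with even degrees has
an Eulerian circuit, so it is enough to check both properties for the
non-commuting graph.

The degrees are even because the neighbours of a vertex u are paired off by
v |-> u - v. As [u, u - v] = - [u, v], this involution preserves the
neighbourhood of u; a fixed point v would satisfy u = v + v, hence [u, v] = 0,
and would not be a neighbour. This works in every characteristic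
([nc_even]).

The graph is connected because any two vertices u, v have a common neighbour:
the centralizers of u and v are proper subgroups of L, and a group is never the
union of two proper subgroups ([nc_common_neighbor]).

Euler's theorem itself ([eulerian_of_even_degrees]) is proved by showing that
a trail, that is a walk repeating no edge, either is an Eulerian circuit or can
be made longer ([trail_extends]), while the length of trails is bounded. If the
trail is not closed, it has used an odd number of edges at its last vertex, so
some edge there remains and the trail continues along it. If it is closed and
misses an edge, then by connectivity it misses an edge incident to one of the
vertices that it visits; the trail is rotated to end at that vertex and
continues along that edge. *)

Set Implicit Arguments.
Unset Strict Implicit.
Unset Printing Implicit Defensive.

Import GRing.Theory.

(** * Sets with a fixed-point-free involution *)

Lemma even_card_involution (T : finType) (f : T -> T) (A : {set T}) :
    {in A, forall y, f y \in A} -> {in A, forall y, f y != y} ->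
    {in A, forall y, f (f y) = y} -> ~~ odd #|A|.
Proof.
have [n] := ubnP #|A|; elim: n A => // n IHn A ltAn fA fN fK.
have [->|[a Aa]] := set_0Vmem A; first by rewrite cards0.
have Afa : f a \in A :\ a by rewrite !inE fN ?fA.
rewrite (cardsD1 a A) (cardsD1 (f a)) Aa Afa /= negbK.
apply: IHn => [|y|y|y]; last 2 first.
- by rewrite !inE => /and3P[_ _]; apply: fN.
- by rewrite !inE => /and3P[_ _]; apply: fK.
- by move: ltAn; rewrite (cardsD1 a A) (cardsD1 (f a)) Aa Afa ltnS => /ltnW.
rewrite !inE => /and3P[yfa ya Ay]; rewrite fA // andbT.
apply/andP; split; last by apply: contraNneq yfa => <-; rewrite fK.
by apply: contraNneq ya => fyfa; rewrite -(fK y) // fyfa fK.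
Qed.

(** * Euler's theorem *)

Section EulerTheorem.

Variable G : sgraph.
Implicit Types (x y u v : G) (p : seq G).

Lemma traversals_cons x y p u v :
  traversals x (y :: p) u v =
    (((x, y) == (u, v)) || ((x, y) == (v, u))) + traversals y p u v.
Proof. by []. Qed.

Lemma traversals_cat x p1 p2 u v :
  traversals x (p1 ++ p2) u v =
    traversals x p1 u v + traversals (last x p1) p2 u v.
Proof.
elim: p1 x => //= y p1 IHp x.
by rewrite !traversals_cons IHp addnA.
Qed.

Lemma traversalsC x p u v : traversals x p u v = traversals x p v u.
Proof. by apply: eq_count => e; rewrite /= orbC. Qed.

Lemma traversals_adj x p u v :
  path (@sadj G) x p -> 0 < traversals x p u v -> sadj u v.
Proof.
elim: p x => //= y p IHp x /andP[xy /IHp{}IHp].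
rewrite traversals_cons.
case: eqP => [[<- <-] //|_]; case: eqP => [[<- <-] _|_]; last exact: IHp.
by rewrite sadj_sym.
Qed.

Lemma traversals_mem x p u v : 0 < traversals x p u v -> u \in x :: p.
Proof.
elim: p x => //= y p IHp x; rewrite traversals_cons in_cons.
case: eqP => [[<- _]|_]; first by rewrite eqxx.
case: eqP => [[_ <-]|_ /IHp->]; last by rewrite orbT.
by rewrite mem_head !orbT.
Qed.

Definition trail x p :=
  path (@sadj G) x p /\ forall u v, traversals x p u v <= 1.

(** The steps of a trail are pairwise distinct ordered pairs of vertices. This
bound is crude, but makes the repeated lengthening of a trail terminate. *)
Lemma trail_size x p : trail x p -> size p <= #|{: G * G}|.
Proof.
case=> _ le1.
have -> : size p = size (zip (x :: p) p) by rewrite size2_zip /=.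
rewrite -(card_uniqP _) ?max_card //; apply: count_mem_uniq => -[u v].
rewrite -has_pred1 has_count.
have : count_mem (u, v) (zip (x :: p) p) <= 1.
  apply: leq_trans (le1 u v); apply: sub_count => e /= ->; exact: orTb.
by case: (count_mem _ _) => [|[|]].
Qed.

(** Each visit of a walk to v in its interior uses one edge to come in and one
to go out, so only the two ends of the walk contribute to the parity; they
cancel when they coincide. *)
Lemma odd_traversals x p v : path (@sadj G) x p ->
  odd (\sum_u traversals x p v u) = (v == x) (+) (v == last x p).
Proof.
elim: p x => [|y p IHp] x /=; first by rewrite big1 // addbb.
case/andP=> xy /IHp{}IHp.
(* Without loops, the first step counts once at each of its two ends. *)
have nxy : x != y by apply: contraTneq xy => ->; rewrite sadj_irr.
under eq_bigr do rewrite traversals_cons.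
rewrite big_split oddD IHp /= addbA; congr addb.
suff -> : \sum_u (((x, y) == (v, u)) || ((x, y) == (u, v))) =
    (v == x) + (v == y) by rewrite oddD !oddb -addbA addbb addbF.
under eq_bigr do rewrite !xpair_eqE.
have [->|vx] := eqVneq v x.
  rewrite (negPf nxy) (bigD1 y) //= !eqxx /= big1 // => u uy.
  by rewrite [y == u]eq_sym (negPf uy) [y == x]eq_sym (negPf nxy) andbF.
have [_|_] := eqVneq v y; last by rewrite big1 // => u _; rewrite andbF.
rewrite (bigD1 x) //= eqxx big1 // => u ux.
by rewrite [x == u]eq_sym (negPf ux).
Qed.

Lemma trail_rcons x p b : trail x p -> sadj (last x p) b ->
  traversals x p (last x p) b = 0 -> trail x (rcons p b).
Proof.
case=> xp le1 ab t0; split=> [|u v]; first by rewrite rcons_path xp.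
rewrite -cats1 traversals_cat traversals_cons addn0.
case: eqP => [[<- <-]|_]; first by rewrite t0.
case: eqP => [[<- <-]|_]; first by rewrite traversalsC t0.
by rewrite addn0.
Qed.

Lemma trail_rotate x p a : trail x p -> last x p = x -> a \in x :: p ->
  exists q, [/\ trail a q, last a q = a, size q = size p
              & forall u v, traversals a q u v = traversals x p u v].
Proof.
move=> tr cl a_p; case/splitPl: a_p tr cl => p1 p2 p1a tr cl.
have {}cl : last a p2 = x by rewrite -[RHS]cl last_cat p1a.
have tE u v : traversals a (p2 ++ p1) u v = traversals x (p1 ++ p2) u v.
  by rewrite !traversals_cat cl p1a addnC.
exists (p2 ++ p1); split=> //; last by rewrite !size_cat addnC.
  case: tr => pth le1; split=> [|u v]; last by rewrite tE.
  by move: pth; rewrite !cat_path p1a cl andbC.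
by rewrite last_cat cl.
Qed.

Hypothesis G_connected : forall x y, connect (@sadj G) x y.
Hypothesis G_even : forall x, ~~ odd #|[set y | sadj x y]|.

(** The parity of the edges used at the end of an open trail is odd, whereas
the degree is even. *)
Lemma open_trail_extends x p : trail x p -> last x p != x ->
  exists2 b, sadj (last x p) b & traversals x p (last x p) b = 0.
Proof.
move=> [xp le1] nclosed; set v := last x p.
have [/existsP[b /andP[vb /eqP]]|/existsPn all_used] :=
  boolP [exists b, sadj v b && (traversals x p v b == 0)]; first by exists b.
have: odd (\sum_u traversals x p v u).
  by rewrite odd_traversals // eqxx (negPf nclosed).
rewrite (eq_bigr (fun u => nat_of_bool (sadj v u))) => [|u _].
  by rewrite -big_mkcond sum1dep_card (negPf (G_even v)).
have := all_used u; have := le1 v u; have := @traversals_adj x p v u xp.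
case: (traversals x p v u) => [_ _|[|//] ->] //.
by rewrite andbT => /negPf->.
Qed.

(** If the missed edge u v does not start on the walk, a path from the walk to u
leaves the set of visited vertices by some edge, which the walk cannot have
used since its far end is not visited. *)
Lemma untraversed_edge_at_walk x p u v : sadj u v -> traversals x p u v = 0 ->
  exists a b, [/\ a \in x :: p, sadj a b & traversals x p a b = 0].
Proof.
move=> uv t0; have [u_p|u_p] := boolP (u \in x :: p); first by exists u, v.
have /connectP[q] := G_connected x u.
have: x \in x :: p by exact: mem_head.
(* The path to u may start anywhere on the walk; the walk itself stays put. *)
move: {1 3 4}x => a; elim: q a => [|b q IHq] a a_p /=.
  by move=> _ ua; rewrite ua a_p in u_p.
case/andP=> ab bq uq; have [b_p|b_p] := boolP (b \in x :: p).
  exact: IHq b_p bq uq.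
exists a, b; split=> //; apply/eqP; rewrite -leqn0 leqNgt traversalsC.
by apply: contra b_p; apply: traversals_mem.
Qed.

Lemma trail_extends x p : trail x p ->
  eulerian G \/ exists y q, trail y q /\ size p < size q.
Proof.
move=> tr; have [cl|ncl] := eqVneq (last x p) x; last first.
  have [b vb t0] := open_trail_extends tr ncl.
  right; exists x, (rcons p b); rewrite size_rcons; split=> //.
  exact: trail_rcons.
have [/existsP[u /existsP[v /andP[uv /eqP t0]]]|all_used] :=
  boolP [exists u, exists v, sadj u v && (traversals x p u v == 0)].
  right; have [a [b [a_p ab tab]]] := untraversed_edge_at_walk uv t0.
  have [q [trq clq sq tE]] := trail_rotate tr cl a_p.
  exists a, (rcons q b); rewrite size_rcons sq; split=> //.
  by apply: trail_rcons; rewrite ?clq ?tE.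
left; case: tr => xp le1; exists x, p; split=> [|u v uv].
  by rewrite /closed_walk xp cl eqxx.
have /existsPn/(_ v) := existsPn all_used u; rewrite uv.
by case: (traversals x p u v) (le1 u v) => [|[|]].
Qed.

Theorem eulerian_of_even_degrees (x0 : G) : eulerian G.
Proof.
(* Induction on the number of steps by which a trail may still grow. *)
have: trail x0 [::] by [].
have [n] := ubnP (#|{: G * G}| - size (Nil G)).
elim: n x0 (Nil G) => [//|n IHn] x p le_n tr.
have [//|[y [q [trq lt_pq]]]] := trail_extends tr.
apply: (IHn _ _ _ trq); rewrite ltnS in le_n; apply: leq_trans le_n.
by apply: ltn_sub2l => //; apply: leq_trans lt_pq (trail_size trq).
Qed.

End EulerTheorem.

(** * The non-commuting graph *)

Section NonCommutingGraph.

Local Open Scope ring_scope.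

Variables (F : finFieldType) (L : finDimLieAlgType F).
Implicit Types (x y z : L).
Local Notation V := (nc_vertex L).

Lemma lieDr x y z : lie x (y + z) = lie x y + lie x z.
Proof. by have := lie_linearr x 1 y z; rewrite !scale1r. Qed.

Lemma lieDl x y z : lie (x + y) z = lie x z + lie y z.
Proof. by have := lie_linearl z 1 x y; rewrite !scale1r. Qed.

Lemma lie_selfBr x y : lie x (x - y) = - lie x y.
Proof.
by apply: (addIr (lie x y)); rewrite -lieDr subrK liexx addNr.
Qed.

Lemma nc_vertexP x : reflect (exists y, lie x y != 0)
  ((x : finvect_type L) \notin lie_center L).
Proof.
by rewrite inE negb_forall; apply: (iffP existsP) => -[y xy]; exists y.
Qed.

Lemma nc_adjE (u v : V) : nc_adj u v = (lie (val u : L) (val v) != 0).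
Proof.
rewrite /nc_adj andb_idl //; apply: contra_neq => ->; exact: liexx.
Qed.

(** The neighbours of u are paired off by v |-> u - v, which also covers
characteristic 2, where v |-> - v would fix everything. *)
Lemma nc_even (u : V) : ~~ odd #|[set v : V | nc_adj u v]|.
Proof.
(* When v is not a neighbour of u, u - v may be central, hence the default. *)
pose mate (v : V) : V := insubd v ((val u : L) - (val v : L)).
have lie_mate (v : V) : nc_adj u v ->
    lie (val u : L) ((val u : L) - (val v : L)) != 0.
  by rewrite nc_adjE lie_selfBr oppr_eq0.
have val_mate (v : V) : nc_adj u v -> val (mate v) = (val u : L) - (val v : L).
  move=> uv; rewrite val_insubd ifT //; apply/nc_vertexP.
  by exists (val u); rewrite lieC oppr_eq0 lie_mate.
have mate_adj (v : V) : nc_adj u v -> nc_adj u (mate v).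
  by move=> uv; rewrite nc_adjE val_mate // lie_mate.
apply: (@even_card_involution _ mate) => v; rewrite !inE => uv.
- exact: mate_adj.
- apply/negP => /eqP/(congr1 val); rewrite val_mate // => E.
  have {E} E : (val u : L) = (val v : L) + val v.
    by rewrite -[X in _ = X + _]E subrK.
  by move: uv; rewrite nc_adjE E lieDl !liexx addr0 eqxx.
- by apply: val_inj; rewrite !val_mate ?mate_adj // opprB addrC subrK.
Qed.

(** L is not the union of the centralizers of u and v: if a commutes
with v but not with u, and b with u but not with v, then a + b commutes with
neither. *)
Lemma nc_common_neighbor (u v : V) : exists w : V, nc_adj u w && nc_adj w v.
Proof.
suff [z uz vz] : exists2 z, lie (val u : L) z != 0 & lie (val v : L) z != 0.
  have zV : (z : finvect_type L) \notin lie_center L.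
    by apply/nc_vertexP; exists (val u); rewrite lieC oppr_eq0.
  exists (Sub (z : finvect_type L) zV : V).
  by rewrite [nc_adj _ v]nc_adj_sym !nc_adjE SubK uz.
have /nc_vertexP[a ua] := valP u; have /nc_vertexP[b vb] := valP v.
have [va|] := eqVneq (lie (val v : L) a) 0; last by exists a.
have [ub|] := eqVneq (lie (val u : L) b) 0; last by exists b.
by exists (a + b); rewrite lieDr ?ub ?va ?addr0 ?add0r.
Qed.

End NonCommutingGraph.

Theorem proposition2p12 (F : finFieldType) (L : finDimLieAlgType F)
    (nonabelian : ~ lie_abelian L) :
  eulerian (noncommuting_graph L).
Proof.
have [v _|noV] := pickP (nc_vertex L); last first.
  case: nonabelian => x y; apply/eqP; apply/negPn/negP => xy.
  have xV : (x : finvect_type L) \notin lie_center L.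
    by apply/nc_vertexP; exists y.
  by have := noV (Sub (x : finvect_type L) xV).
apply: (@eulerian_of_even_degrees (noncommuting_graph L)) v => u.
  move=> v; have [w /andP[uw wv]] := nc_common_neighbor u v.
  by apply: (connect_trans (y := w)); apply: connect1.
exact: nc_even.
Qed.
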